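(* Let $L$ be any finite lattice and let $\unlhd$ be any partial order on the set $A(L)$ of atoms of $L$. Then for all $x\in L$, $$\mu(x)=\sum_{B}(-1)^{|B|},$$ where the sum is over all NBB bases $B\subseteq A(L)$ of $x$ (with respect to $\unlhd$) and $|B|$ denotes the cardinality of $B$.
   Context: $L$ is a finite lattice with order $\le$, join $\vee$, meet $\wedge$, least element $\hat 0$ and greatest element $\hat 1$. $A(L)$ is the set of atoms (elements covering $\hat 0$). $\bigvee D$ is the join in $L$ of $D\subseteq A(L)$, with $\bigvee\emptyset=\hat 0$. The Möbius function $\mu:L\to\mathbb{Z}$ is defined recursively by $\mu(\hat 0)=1$ and $\mu(x)=-\sum_{y<x}\mu(y)$ for $x>\hat 0$. The partial order $\unlhd$ on $A(L)$ is arbitrary (unrelated to $\le$), with strict part $\lhd$. A nonempty set $D\subseteq A(L)$ is bounded below (BB) if for every $d\in D$ there is an $a\in A(L)$ such that $a\lhd d$ and $a<\bigvee D$ (strictly, in $L$). A set $B\subseteq A(L)$ is NBB if it contains no subset $D$ which is BB. An NBB base of $x\in L$ is an NBB set $B$ with $\bigvee B=x$. *)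

(* Defs.v *)
From HB Require Import structures.
From mathcomp Require Import all_boot all_order all_algebra.

Set Implicit Arguments.
Unset Strict Implicit.
Unset Printing Implicit Defensive.

Import Order.Theory GRing.Theory.
Local Open Scope ring_scope.

Lemma finporder_lt_wf d (P : finPOrderType d) :
  well_founded (fun x y : P => (x < y)%O).
Proof.
suff wf_n n (x : P) :
    (#|[set y : P | (y < x)%O]| < n)%N -> Acc (fun x y : P => (x < y)%O) x.
  by move=> x; apply: (wf_n _ x (ltnSn _)).
elim: n x => [|n IHn] x.
  by rewrite ltn0.
rewrite ltnS => le_x_n.
apply: Acc_intro => y lt_yx; apply: (IHn y).
apply: leq_trans le_x_n; apply: proper_card; apply/properP; split.
  by apply/subsetP=> z; rewrite !inE => /lt_trans; apply.
by exists y; rewrite !inE ?ltxx.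
Qed.

Definition mobius_step d (L : finTBLatticeType d) (x : L)
    (mu : forall y : L, (y < x)%O -> int) : int :=
  if x == \bot%O then 1
  else - \sum_(y : {y : L | (y < x)%O}) mu (val y) (valP y).

Definition mobius d (L : finTBLatticeType d) : L -> int :=
  Fix (@finporder_lt_wf d L) (fun=> int) (@mobius_step d L).

Lemma mobius_unfold d (L : finTBLatticeType d) (x : L) :
  mobius x = if x == \bot%O then 1 else - \sum_(y : L | (y < x)%O) mobius y.
Proof.
rewrite /mobius Fix_eq => [|{}x f g eq_fg]; last first.
  by rewrite /mobius_step; case: eqP => // _; congr (- _); apply: eq_bigr.
rewrite {1}/mobius_step; case: eqP => // _; congr (- _).
exact/esym/(big_sub (fun y : L => (y < x)%O)).
Qed.

Lemma mobius_bot d (L : finTBLatticeType d) : mobius (\bot%O : L) = 1.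
Proof. by rewrite mobius_unfold eqxx. Qed.

Lemma mobius_rec d (L : finTBLatticeType d) (x : L) :
  (\bot < x)%O -> mobius x = - \sum_(y : L | (y < x)%O) mobius y.
Proof. by move=> /gt_eqF x0; rewrite mobius_unfold x0. Qed.

Definition covers d (P : finPOrderType d) (x y : P) : bool :=
  (x < y)%O && [forall z : P, ~~ ((x < z) && (z < y))%O].

Definition is_atom d (L : finTBLatticeType d) (a : L) : bool :=
  covers \bot%O a.

Definition atoms d (L : finTBLatticeType d) : predArgType :=
  {a : L | is_atom a}.

HB.instance Definition _ d (L : finTBLatticeType d) :=
  [isSub of atoms L for @proj1_sig L (fun a => is_atom a)].
HB.instance Definition _ d (L : finTBLatticeType d) :=
  [Finite of atoms L by <:].

Definition partial_order (T : Type) (le : rel T) : Prop :=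
  [/\ reflexive le, antisymmetric le & transitive le].

Definition strict (T : eqType) (le : rel T) : rel T :=
  fun a b => (a != b) && le a b.

Section NBB.

Variables (d : Order.disp_t) (L : finTBLatticeType d) (tle : rel (atoms L)).
Implicit Types B D : {set atoms L}.

Definition join_atoms D : L := (\join_(a in D) val a)%O.

Definition bounded_below D : bool :=
  (D != set0) &&
  [forall b in D, [exists a : atoms L,
     strict tle a b && (val a < join_atoms D)%O]].

Definition NBB B : bool :=
  [forall D : {set atoms L}, (D \subset B) ==> ~~ bounded_below D].

Definition NBB_base (x : L) B : bool := NBB B && (join_atoms B == x).

End NBB.

(* Main.v *)
Require Import Defs.
From mathcomp Require Import all_boot all_order all_algebra.
Set Implicit Arguments.
Unset Strict Implicit.
Unset Printing Implicit Defensive.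
Import Order.Theory GRing.Theory.
Local Open Scope ring_scope.

(** Let [f x] be the signed count of the NBB bases of [x].  The recursion that
    defines [mobius] says that its sums over the principal ideals
    [{y | y <= x}] are 1 for [x] the bottom and 0 otherwise, so it is enough
    to see that [f] has the same sums (lemma [sum_NBB_le]).  Gathering the NBB
    sets according to their joins, the sum of [f] over the [y <= x] is the
    signed count of all NBB sets of atoms below [x].

    For [x] the bottom only the empty set is counted.  Otherwise there is an
    atom below [x]; choose such an atom [a] that is minimal for the given
    order on atoms.  Inserting [a] into an NBB set [B] of atoms below [x]
    cannot create a bounded below subset [D]: such a [D] would have to contain
    [a], and then some atom strictly preceding [a] would lie below the join of
    [D], hence below [x], contrary to the choice of [a] (lemma [NBB_setU1]).
    Removing [a] preserves NBB trivially, so toggling [a] is an involution of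
    these sets that reverses the sign, and the count vanishes. *)

(** A strict order on a finite type is well founded: an element of [P] with
    fewest [r]-predecessors is [r]-minimal in [P]. *)
Lemma exists_minimal (T : finType) (r : rel T) (P : pred T) (x0 : T) :
    irreflexive r -> transitive r -> P x0 ->
  exists2 m, P m & forall y, P y -> ~~ r y m.
Proof.
move=> r_irr r_tr Px0.
case: (arg_minnP (fun m => #|[set z | r z m]|) Px0) => m Pm min_m.
exists m => // y /min_m; apply: contraTN => r_ym; rewrite -ltnNge.
apply: proper_card; apply/properP; split.
  by apply/subsetP=> z; rewrite !inE => /r_tr; apply.
by exists y; rewrite !inE ?r_irr.
Qed.

(** Pairing each set [B] that misses [a] with [a |: B] cancels all the terms,
    whenever membership in the family [Q] does not depend on [a]. *)
Lemma sum_sign_toggle (R : pzRingType) (T : finType) (a : T)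
    (Q : pred {set T}) :
    (forall B, Q (a |: B) = Q B) ->
  \sum_(B : {set T} | Q B) (-1) ^+ #|B| = 0 :> R.
Proof.
move=> QU1; rewrite (bigID (fun B : {set T} => a \in B)) /=.
rewrite (reindex_onto (fun B => a |: B) (fun B => B :\ a)) /=; last first.
  by move=> B /andP[_ aB]; rewrite setD1K.
rewrite (eq_bigl (fun B => Q B && (a \notin B))) => [|B]; last first.
  rewrite QU1 setU11 andbT; congr (_ && _).
  apply/eqP/idP => [<-|/setU1K//]; by rewrite setD11.
rewrite -big_split big1 //= => B /andP[_ aNB].
by rewrite cardsU1 aNB exprS mulN1r addNr.
Qed.

Section NBBCount.

Variables (d : Order.disp_t) (L : finTBLatticeType d) (tle : rel (atoms L)).
Hypothesis tle_po : partial_order tle.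
Implicit Types (x : L) (a b : atoms L) (B D : {set atoms L}).

Lemma strict_irr : irreflexive (strict tle).
Proof. by move=> a; rewrite /strict eqxx. Qed.

Lemma strict_trans : transitive (strict tle).
Proof.
case: tle_po => _ anti tr b a c /andP[neq_ab ab] /andP[_ bc].
rewrite /strict (tr _ _ _ ab bc) andbT.
apply: contraNneq neq_ab => eq_ac; rewrite -eq_ac in bc.
by apply/eqP/anti; rewrite ab.
Qed.

Lemma atom_gt0 a : (\bot < val a)%O.
Proof. by case/andP: (valP a). Qed.

Lemma exists_atom_le x : (\bot < x)%O -> exists a, (val a <= x)%O.
Proof.
move=> x_gt0.
have [|||m /andP[m_gt0 le_mx] min_m] :=
    @exists_minimal L <%O (fun y => (\bot < y)%O && (y <= x)%O) x.
- exact: ltxx.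
- exact: lt_trans.
- by rewrite x_gt0 lexx.
have m_atom : is_atom m.
  rewrite /is_atom /covers m_gt0; apply/forallP=> z.
  apply/negP=> /andP[z_gt0 lt_zm].
  have /min_m : (\bot < z)%O && (z <= x)%O.
    by rewrite z_gt0 (ltW (lt_le_trans lt_zm le_mx)).
  by rewrite lt_zm.
by exists (Sub m m_atom); rewrite SubK.
Qed.

Lemma join_atoms_leP B x :
  reflect (forall b, b \in B -> (val b <= x)%O) (join_atoms B <= x)%O.
Proof. exact: joinsP. Qed.

Lemma join_atoms_sub_le B D x :
  D \subset B -> (join_atoms B <= x)%O -> (join_atoms D <= x)%O.
Proof.
by move=> /subsetP sDB /join_atoms_leP le_Bx; apply/join_atoms_leP=> b /sDB/le_Bx.
Qed.

Lemma join_atomsU1_le a B x :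
  (val a <= x)%O -> (join_atoms (a |: B) <= x)%O = (join_atoms B <= x)%O.
Proof.
move=> le_ax; apply/idP/idP; first exact/join_atoms_sub_le/subsetUr.
move=> /join_atoms_leP le_Bx; apply/join_atoms_leP=> b.
by case/setU1P=> [->|/le_Bx].
Qed.

Lemma NBB_sub B D : D \subset B -> NBB tle B -> NBB tle D.
Proof.
move=> sDB /forallP nbbB; apply/forallP=> E; apply/implyP=> sED.
exact/(implyP (nbbB E))/(subset_trans sED).
Qed.

(** A bounded below set contained in [a |: B] but not in [B] contains [a], so
    it yields an atom strictly preceding [a] and lying below its join, which
    is at most [x]. *)
Lemma NBB_setU1 x a B :
    (val a <= x)%O -> (forall b, (val b <= x)%O -> ~~ strict tle b a) ->
    (join_atoms B <= x)%O ->
  NBB tle (a |: B) = NBB tle B.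
Proof.
move=> le_ax min_a le_Bx; apply/idP/idP; first exact/NBB_sub/subsetUr.
move=> /forallP nbbB; apply/forallP=> D; apply/implyP=> sDaB.
have [aD|aND] := boolP (a \in D); last first.
  apply: (implyP (nbbB D)); apply/subsetP=> b bD.
  case/setU1P: (subsetP sDaB b bD) => // eq_ba.
  by rewrite -eq_ba bD in aND.
apply/negP=> /andP[_ /forallP/(_ a)]; rewrite aD /=.
case/existsP=> b /andP[lt_ba lt_bD].
suff /min_a/negP : (val b <= x)%O by apply.
apply: le_trans (ltW lt_bD) _.
by apply: join_atoms_sub_le sDaB _; rewrite join_atomsU1_le.
Qed.

Lemma NBB_set0 : NBB tle set0.
Proof.
apply/forallP=> D; apply/implyP; rewrite subset0 => /eqP->.
by rewrite /bounded_below eqxx.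
Qed.

Lemma join_atoms_le0 B : (join_atoms B <= \bot)%O = (B == set0).
Proof.
apply/idP/eqP => [/join_atoms_leP le_B0|->]; last first.
  by apply/join_atoms_leP=> b; rewrite inE.
apply/setP=> b; rewrite inE; apply/negP=> /le_B0/le_gtF.
by rewrite atom_gt0.
Qed.

Lemma sum_NBB_le x :
  \sum_(B | NBB tle B && (join_atoms B <= x)%O) (-1) ^+ #|B|
    = (x == \bot%O)%:R :> int.
Proof.
have [->|x_neq0] := eqVneq x \bot%O.
  rewrite (big_pred1 set0) ?cards0 // => B /=; rewrite join_atoms_le0.
  by have [->|_] := eqVneq B set0; rewrite ?NBB_set0 ?andbF.
have /exists_atom_le[a0 le_a0x] : (\bot < x)%O by rewrite lt0x.
have [a le_ax min_a] := @exists_minimal _ _ (fun a => (val a <= x)%O) a0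
  strict_irr strict_trans le_a0x.
apply: (@sum_sign_toggle _ _ a) => B; rewrite join_atomsU1_le //.
have [le_Bx|_] := boolP (join_atoms B <= x)%O; last by rewrite !andbF.
by rewrite (@NBB_setU1 x).
Qed.

Lemma sum_NBB_base_le x :
  \sum_(y | (y <= x)%O) \sum_(B | NBB_base tle y B) (-1) ^+ #|B|
    = (x == \bot%O)%:R :> int.
Proof.
rewrite -sum_NBB_le.
rewrite [RHS](partition_big (@join_atoms d L) (fun y => (y <= x)%O)) /=.
  apply: eq_bigr => y le_yx; apply: eq_bigl => B; rewrite /NBB_base.
  by have [->|_] := eqVneq (join_atoms B) y; rewrite ?le_yx ?andbF ?andbT.
by move=> B /andP[].
Qed.

End NBBCount.

(** The recursion for [mobius] in summed form, uniform in [x]. *)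
Lemma sum_mobius_le (d : Order.disp_t) (L : finTBLatticeType d) (x : L) :
  \sum_(y : L | (y <= x)%O) mobius y = (x == \bot%O)%:R.
Proof.
rewrite (bigD1 x) //= (eq_bigl (fun y => (y < x)%O)) => [|y]; last first.
  by rewrite andbC lt_neqAle.
rewrite mobius_unfold.
have [->|_] := eqVneq x \bot%O; last by rewrite addNr.
by rewrite big_pred0 ?addr0 // => y; rewrite ltx0.
Qed.

(** The summation operator over principal ideals is unitriangular. *)
Lemma sum_le_inj (d : Order.disp_t) (P : finPOrderType d) (V : zmodType)
    (f g : P -> V) :
    (forall x, \sum_(y | (y <= x)%O) f y = \sum_(y | (y <= x)%O) g y) ->
  f =1 g.
Proof.
move=> eq_fg; apply: (well_founded_ind (@finporder_lt_wf _ P)) => x IHx.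
have := eq_fg x; rewrite (bigD1 x) //= [RHS](bigD1 x) //=.
rewrite (eq_bigr g) => [/addIr//|y /andP[le_yx neq_yx]].
by apply: IHx; rewrite lt_neqAle neq_yx.
Qed.

Theorem theorem1p1 (d : Order.disp_t) (L : finTBLatticeType d)
    (tle : rel (atoms L)) (tle_po : partial_order tle) (x : L) :
  mobius x = \sum_(B : {set atoms L} | NBB_base tle x B) (-1) ^+ #|B|.
Proof.
move: x; apply: sum_le_inj => x.
by rewrite sum_mobius_le sum_NBB_base_le.
Qed.
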